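(* Let $\lambda$ and $x$ be indeterminates. Define the lower-triangular matrix $\mathsf{L}^{(-1+\lambda)}=(\ell_{n,k})_{n,k\ge 0}$ by $\ell_{n,k}=\binom{n}{k}(\lambda+k)^{\overline{n-k}}$ for $0\le k\le n$ and $\ell_{n,k}=0$ for $k>n$; define $B_x=(\binom{i}{j}x^{i-j})_{i,j\ge 0}$; and define the polynomials $$\mathcal{L}_n^{(-1+\lambda)}(x)=\sum_{k=0}^n\binom{n}{k}(\lambda+k)^{\overline{n-k}}x^k,\qquad \overline{\mathcal{L}}_n^{(-1+\lambda)}(x)=x^n\mathcal{L}_n^{(-1+\lambda)}(1/x)=\sum_{k=0}^n\binom{n}{k}(\lambda+n-k)^{\overline{k}}x^k .$$ Then: (a) $\mathsf{L}^{(-1+\lambda)}$ is totally positive in $\mathbb{Z}[\lambda]$ equipped with the coefficientwise order. (b) $\mathsf{L}^{(-1+\lambda)}B_x$ is totally positive in $\mathbb{Z}[x,\lambda]$ equipped with the coefficientwise order. (c) The sequence $(\mathcal{L}_n^{(-1+\lambda)}(x))_{n\ge 0}$ is Hankel-totally positive in $\mathbb{Z}[x,\lambda]$ equipped with the coefficientwise order. (d) The sequence $(\overline{\mathcal{L}}_n^{(-1+\lambda)}(x))_{n\ge 0}$ is Hankel-totally positive in $\mathbb{Z}[x,\lambda]$ equipped with the coefficientwise order.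
   Context: $\rho^{\overline{m}}=\rho(\rho+1)\cdots(\rho+m-1)$ (rising power, equal to $1$ for $m=0$). The polynomials $\mathcal{L}_n^{(\alpha)}(x)=n!\,L_n^{(\alpha)}(-x)$ are the monic unsigned Laguerre polynomials, here with $\alpha=-1+\lambda$. A matrix with entries in a polynomial ring is totally positive in the coefficientwise order if every minor is a polynomial with nonnegative coefficients. A sequence $(a_n)_{n\ge0}$ is Hankel-totally positive if the infinite Hankel matrix $(a_{i+j})_{i,j\ge 0}$ is totally positive. *)

(* Defs.v *)
From mathcomp Require Import all_boot all_order all_algebra.

Set Implicit Arguments.
Unset Strict Implicit.
Unset Printing Implicit Defensive.

Import Order.TTheory GRing.Theory Num.Theory.
Local Open Scope ring_scope.

(* Z[lambda] is {poly int}, with lambda = 'X; Z[x, lambda] is                 *)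
(* {poly {poly int}} = Z[lambda][x], with x = 'X and lambda = 'X%:P.          *)
(* In each, the positive cone of the coefficientwise order consists of the    *)
(* polynomials all of whose (integer) coefficients are nonnegative.           *)
Definition coefwise_nneg (p : {poly int}) : Prop :=
  forall i : nat, 0 <= p`_i.
Definition coefwise_nneg2 (p : {poly {poly int}}) : Prop :=
  forall i j : nat, 0 <= p`_i`_j.

Section Defs.

Variable R : comNzRingType.
Implicit Types (A B : nat -> nat -> R) (a : nat -> R) (lam x : R) (n k : nat).

(* Infinite matrices are functions nat -> nat -> R. The order on R is given   *)
(* by its positive cone nneg; a minor is selected by strictly increasing      *)
(* sequences f of row indices and g of column indices.                        *)
Definition totally_positive (nneg : R -> Prop) A : Prop :=
  forall (r : nat) (f g : 'I_r -> nat),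
    (forall i j : 'I_r, (i < j)%N -> (f i < f j)%N) ->
    (forall i j : 'I_r, (i < j)%N -> (g i < g j)%N) ->
  nneg (\det (\matrix_(i < r, j < r) A (f i) (g j))).

Definition hankel_totally_positive (nneg : R -> Prop) a : Prop :=
  totally_positive nneg (fun i j => a (i + j)%N).

(* The infinite matrix product A B for A lower-triangular: the terms of index *)
(* i > n in the sum vanish.                                                   *)
Definition lower_mul A B : nat -> nat -> R :=
  fun n k => \sum_(i < n.+1) A n i * B i k.

Definition rising (rho : R) (m : nat) : R := \prod_(i < m) (rho + i%:R).

Definition laguerre_mx lam : nat -> nat -> R :=
  fun n k =>
    if (k <= n)%N then 'C(n, k)%:R * rising (lam + k%:R) (n - k) else 0.

(* For j > i the truncated exponent is harmless, since 'C(i, j) = 0.          *)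
Definition binomial_mx x : nat -> nat -> R :=
  fun i j => 'C(i, j)%:R * x ^+ (i - j).

Definition laguerre lam x n : R :=
  \sum_(k < n.+1) 'C(n, k)%:R * rising (lam + k%:R) (n - k) * x ^+ k.

Definition rev_laguerre lam x n : R :=
  \sum_(k < n.+1) 'C(n, k)%:R * rising (lam + (n - k)%:R) k * x ^+ k.

End Defs.

(* This applies to the images of lambda and x in the fraction field of        *)
(* Z[x, lambda], where 1/x makes sense.                                       *)
Lemma rev_laguerreE (F : fieldType) (lam x : F) (n : nat) :
  x != 0 -> rev_laguerre lam x n = x ^+ n * laguerre lam x^-1 n.
Proof.
move=> x_neq0; rewrite /rev_laguerre /laguerre big_distrr /=.
rewrite [RHS](reindex_inj rev_ord_inj) /=.
apply: eq_bigr => k _; have le_kn : (k <= n)%N by rewrite -ltnS.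
rewrite subSS bin_sub // subKn // mulrCA; congr (_ * _).
by rewrite exprVn -{2}(subnK le_kn) exprD mulrAC mulfV ?mul1r // expf_neq0.
Qed.

(* Main.v *)
(* Put z^[m] = z (z + 1) ... (z + m - 1).  The homogenized Laguerre           *)
(* polynomials h_n = sum_k 'C(n, k) (lambda + k)^[n - k] y^(n - k) 'X^k       *)
(* satisfy h_n + y h_n' = h_n[lambda := lambda + 1] and                       *)
(* h_(n + 1) = lambda y h_n[lambda + 1] + 'X h_n[lambda + 2].  Hence the      *)
(* coefficients of h_n('X + x) are the rows e_0 P^n generated by the          *)
(* production matrix P = E (lambda y I + E D), where right multiplication by  *)
(* E is 1 + y d/d'X and right multiplication by D is multiplication by        *)
(* 'X + x.  By Cauchy-Binet it suffices to factor P into totally positive     *)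
(* matrices: E is bidiagonal, and lambda y I + E D is the product of two      *)
(* matrices obtained by interleaving I with E and lambda y I with D.  All     *)
(* factors are "staircases", whose minors reduce to the diagonal term.        *)
(* Total positivity of P passes to the matrix of the rows e_0 P^n, and to the *)
(* Hankel matrix of its column 0 because                                      *)
(* e_0 P^(i + j) e_0^T = (e_0 P^i) (P^j e_0^T).                               *)
(* Parts (a), (b), (c) are x = 0, x, x with y = 1; swapping the roles of x    *)
(* and y reverses the Laguerre polynomials, so (d) is x = 1 with y := x.      *)

Require Import Defs.
From mathcomp Require Import all_boot all_order all_fingroup all_algebra.
From mathcomp Require Import ring zify.

Set Implicit Arguments.
Unset Strict Implicit.
Unset Printing Implicit Defensive.

Import Order.TTheory GRing.Theory Num.Theory.
Local Open Scope ring_scope.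

(** The argument runs over an abstract positive cone, so it covers Z[lambda] and Z[x, lambda] at
    once. As a cone is closed under sums and products, [cauchy_binet] makes total positivity stable
    under products ([tp_trunc_mul]); the factors to start from are so sparse that a minor has at
    most one nonzero Leibniz term ([tp_staircase]). For totally positive P, the rows e_0 P^n form a
    totally positive matrix ([tp_output]), since this matrix is e_0 stacked on its own product with
    P; the moments e_0 P^n e_0^T are then Hankel-totally positive ([tp_hankel_output]).

    The Laguerre input is [diff_hlaguerre] and [hlaguerreS]: together they give h_(n + 1) = lambda y
    diff h_n + 'X diff (diff h_n), and the shift 'X -> 'X + x turns this into [iter_laguerre_step].
    Infinite matrices are truncated: a minor sees only finitely many entries ([tp_local]), and N
    rows of P suffice for e_0 P^n when n <= N ([output_laguerre_prod]). *)

(** * The Cauchy-Binet formula *)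

Definition increasingb (r N : nat) (g : {ffun 'I_r -> 'I_N}) :=
  [forall i : 'I_r, forall j : 'I_r, (i < j)%N ==> (g i < g j)%N].

Lemma increasingP (r N : nat) (g : {ffun 'I_r -> 'I_N}) :
  reflect (forall i j : 'I_r, (i < j)%N -> (g i < g j)%N) (increasingb g).
Proof.
apply: (iffP forallP) => [g_incr i j|g_incr i].
  by move/forallP: (g_incr i) => /(_ j)/implyP.
by apply/forallP => j; apply/implyP; apply: g_incr.
Qed.

Lemma homo_ltn_inj (r : nat) (f : 'I_r -> nat) :
  (forall i j : 'I_r, (i < j)%N -> (f i < f j)%N) -> injective f.
Proof.
move=> f_incr i j eq_f; apply/val_inj/eqP.
by case: ltngtP (f_incr i j) (f_incr j i) => // [_ /(_ isT)|_ _ /(_ isT)];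
  rewrite eq_f ltnn.
Qed.

Section Rank.

Variables (r N : nat).
Implicit Type h : {ffun 'I_r -> 'I_N}.

Lemma rank_subproof h i : (#|[set j | h j < h i]%N| < r)%N.
Proof.
rewrite -[X in (_ < X)%N]card_ord -cardsT; apply: proper_card.
by rewrite properT; apply/negP => /eqP/setP/(_ i); rewrite !inE ltnn.
Qed.

Definition rank h i : 'I_r := Ordinal (rank_subproof h i).

Lemma leq_rank h i j : (h i <= h j)%N -> (rank h i <= rank h j)%N.
Proof.
move=> le_hij; apply: subset_leq_card; apply/subsetP=> k; rewrite !inE.
by move/leq_trans; apply.
Qed.

Lemma ltn_rank h i j : (rank h i < rank h j)%N = (h i < h j)%N.
Proof.
apply/idP/idP => [|lt_hij].
  by apply: contraTT; rewrite -!leqNgt => /leq_rank.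
apply: proper_card; apply/properP; split.
  by apply/subsetP=> k; rewrite !inE => /ltn_trans; apply.
by exists i; rewrite !inE ?ltnn.
Qed.

Lemma rank_inj h : injective h -> injective (rank h).
Proof.
move=> h_inj i j eq_rank; apply/h_inj/val_inj/eqP.
by case: ltngtP => //; rewrite -ltn_rank eq_rank ltnn.
Qed.

(** This gives uniqueness in the factorization of an injective map as an increasing map after a
    permutation: the permutation is recovered by counting smaller values. *)
Lemma rank_perm (g : {ffun 'I_r -> 'I_N}) (s : 'S_r) :
  (forall i j : 'I_r, (i < j)%N -> (g i < g j)%N) ->
  rank [ffun i => g (s i)] =1 s.
Proof.
move=> g_incr i; apply: val_inj => /=.
have ltn_g k l : (g k < g l)%N = (k < l)%N.
  apply/idP/idP; last exact: g_incr.
  apply: contraTT; rewrite -!leqNgt [(l <= k)%N]leq_eqVlt.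
  by case/predU1P=> [/val_inj->//|/g_incr/ltnW].
rewrite -(card_imset _ (@perm_inj _ s)).
have -> : s @: [set j | [ffun i => g (s i)] j < [ffun i => g (s i)] i]%N =
    [set k : 'I_r | (k < s i)%N].
  apply/setP=> k; rewrite inE; apply/imsetP/idP => [[j]|lt_ks].
    by rewrite inE !ffunE ltn_g => lt_j ->.
  by exists (s^-1 k)%g; rewrite ?inE ?ffunE ?ltn_g permKV.
rewrite -sum1dep_card (big_ord_narrow (ltnW (ltn_ord (s i)))).
by rewrite sum1_card card_ord.
Qed.

End Rank.

Lemma cauchy_binet (R : comNzRingType) (r N : nat)
  (A : 'M[R]_(r, N)) (B : 'M_(N, r)) :
  \det (A *m B) =
  \sum_(g : {ffun 'I_r -> 'I_N} | increasingb g)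
    \det (colsub g A) * \det (rowsub g B).
Proof.
pose F (h : {ffun 'I_r -> 'I_N}) := (\prod_i A i (h i)) * \det (rowsub h B).
(* Expand every row of the product by multilinearity; a non-injective h then contributes a
   determinant with two equal rows. *)
transitivity (\sum_h F h).
  pose AB (s : 'S_r) i l := A i l * B l (s i).
  transitivity (\sum_(h : {ffun 'I_r -> 'I_N})
      \sum_(s : 'S_r) (-1) ^+ s * \prod_i AB s i (h i)).
    rewrite exchange_big; apply: eq_bigr => /= s _; rewrite -big_distrr /=.
    congr (_ * _); rewrite -(bigA_distr_bigA (AB s)) /=.
    by apply: eq_bigr => i _; rewrite mxE.
  apply: eq_bigr => h _; rewrite /F big_distrr /=; apply: eq_bigr => s _.
  rewrite mulrCA big_split //=; congr (_ * (_ * _)).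
  by apply: eq_bigr => i _; rewrite mxE.
rewrite (bigID (fun h : {ffun _} => injectiveb h)) /= addrC.
rewrite big1 ?add0r => [|h]; last first.
  case/injectivePn=> i1 [i2 Di12 Eh12]; rewrite /F.
  by rewrite (determinant_alternate Di12) ?mulr0 //= => j; rewrite !mxE Eh12.
(* An injective h factors uniquely as g \o s with g increasing and s a        *)
(* permutation, namely s = rank h.                                            *)
under [RHS]eq_bigr => g _ do rewrite big_distrl /=.
rewrite [RHS]pair_big_dep /=.
pose comp (p : {ffun 'I_r -> 'I_N} * 'S_r) : {ffun 'I_r -> 'I_N} :=
  [ffun i => p.1 (p.2 i)].
pose sortp (h : {ffun 'I_r -> 'I_N}) : 'S_r :=
  insubd (1%g : 'S_r) [ffun i => rank h i].
have sortpE (h : {ffun 'I_r -> 'I_N}) i : injective h -> sortp h i = rank h i.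
  move=> /rank_inj h_inj; rewrite -pvalE insubdK ?ffunE //.
  by apply/injectiveP => k l; rewrite !ffunE => /h_inj.
pose sort_pair (h : {ffun 'I_r -> 'I_N}) : {ffun 'I_r -> 'I_N} * 'S_r :=
   ([ffun i => h ((sortp h)^-1%g i)], sortp h).
rewrite (reindex_onto comp sort_pair) /=; last first.
  by move=> h _; apply/ffunP=> i; rewrite !ffunE permK.
apply: eq_big => [[g s]|[g s] _].
  rewrite /= andbT; apply/andP/idP => [[/injectiveP h_inj]|/increasingP g_incr].
    rewrite /sort_pair xpair_eqE => /andP[/eqP def_g _].
    move: (comp (g, s)) h_inj def_g => h h_inj def_g.
    apply/increasingP => i j; rewrite -def_g !ffunE -ltn_rank.
    by rewrite -!sortpE // !permKV.
  have h_inj : injective (comp (g, s)).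
    move=> i j; rewrite !ffunE /= => /(congr1 val)/(homo_ltn_inj g_incr).
    exact: perm_inj.
  split; first exact/injectiveP.
  have def_s : sortp (comp (g, s)) = s.
    by apply/permP => i; rewrite sortpE // rank_perm.
  rewrite /sort_pair def_s xpair_eqE eqxx andbT; apply/eqP/ffunP => i.
  by rewrite !ffunE /= permKV.
rewrite /F /=.
have -> : rowsub (comp (g, s)) B = row_perm s (rowsub g B).
  by apply/matrixP => i j; rewrite !mxE ffunE.
rewrite row_permE det_mulmx det_perm mulrCA mulrA; congr (_ * _ * _).
by apply: eq_bigr => i _; rewrite !mxE ffunE.
Qed.

(** * Total positivity over an abstract cone *)

Definition semiring_cone (R : comNzRingType) (C : R -> Prop) :=
  [/\ C 0, C 1, forall a b, C a -> C b -> C (a + b)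
    & forall a b, C a -> C b -> C (a * b)].

Definition trunc_mul (R : comNzRingType) N (A B : nat -> nat -> R)
    (i j : nat) : R :=
  \sum_(l < N) A i l * B l j.

Definition cons_row (R : comNzRingType) (A : nat -> nat -> R) (i j : nat) : R :=
  if i is i'.+1 then A i' j else (j == 0)%:R.

(* Row n is e_0 P^n, with P truncated to its first N rows. *)
Fixpoint output (R : comNzRingType) N (P : nat -> nat -> R) (n k : nat) : R :=
  if n is n'.+1 then \sum_(j < N) output N P n' j * P j k else (k == 0)%:R.

Section TotalPositivity.

Variables (R : comNzRingType) (C : R -> Prop).
Hypothesis C_cone : semiring_cone C.
Implicit Types (A B P : nat -> nat -> R).

Let C0 : C 0. Proof. by case: C_cone. Qed.
Let C1 : C 1. Proof. by case: C_cone. Qed.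
Let CD a b : C a -> C b -> C (a + b).
Proof. by case: C_cone => _ _ + _; apply. Qed.
Let CM a b : C a -> C b -> C (a * b).
Proof. by case: C_cone => _ _ _; apply. Qed.

Lemma cone_nat n : C n%:R.
Proof. by elim: n => [|n Cn] //; rewrite -natr1; apply: CD. Qed.

Lemma tp_local A :
  (forall b, exists2 A', totally_positive C A' &
     forall i j, (i < b)%N -> (j < b)%N -> A i j = A' i j) ->
  totally_positive C A.
Proof.
move=> A_local r f g f_incr g_incr.
have [A' A'_tp eq_AA'] := A_local (\max_i f i + \max_i g i).+1%N.
have -> : \matrix_(i < r, j < r) A (f i) (g j) = \matrix_(i, j) A' (f i) (g j).
  apply/matrixP=> i j; rewrite !mxE eq_AA' // ltnS.
    exact: leq_trans (leq_bigmax i) (leq_addr _ _).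
  exact: leq_trans (leq_bigmax j) (leq_addl _ _).
exact: A'_tp.
Qed.

Lemma eq_tp A B : A =2 B -> totally_positive C A -> totally_positive C B.
Proof. by move=> eq_AB A_tp; apply: tp_local => b; exists A. Qed.

Lemma tp_tr A : totally_positive C A -> totally_positive C (fun i j => A j i).
Proof.
move=> A_tp r f g f_incr g_incr; rewrite -det_tr.
have -> : (\matrix_(i < r, j < r) A (g j) (f i))^T =
    \matrix_(i, j) A (g i) (f j).
  by apply/matrixP=> i j; rewrite !mxE.
exact: A_tp.
Qed.

Lemma tp_trunc_mul N A B :
  totally_positive C A -> totally_positive C B ->
  totally_positive C (trunc_mul N A B).
Proof.
move=> A_tp B_tp r f g f_incr g_incr.
have -> : \matrix_(i < r, j < r) trunc_mul N A B (f i) (g j) =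
    (\matrix_(i < r, l < N) A (f i) l) *m (\matrix_(l < N, j < r) B l (g j)).
  by apply/matrixP=> i j; rewrite !mxE; apply: eq_bigr => l _; rewrite !mxE.
rewrite cauchy_binet; elim/big_ind: _ => // h /increasingP h_incr; apply: CM.
  have -> : colsub h (\matrix_(i < r, l < N) A (f i) l) =
      \matrix_(i, j) A (f i) (h j) by apply/matrixP=> i j; rewrite !mxE.
  exact: A_tp.
have -> : rowsub h (\matrix_(l < N, j < r) B l (g j)) =
    \matrix_(i, j) B (h i) (g j) by apply/matrixP=> i j; rewrite !mxE.
exact: B_tp.
Qed.

(** A nonzero Leibniz term must pick columns weakly increasing with the rows. Its permutation is
    then increasing, hence the identity, so only the diagonal product remains. *)
Lemma tp_staircase A :
  (forall i j, C (A i j)) ->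
  (forall i i' j j', (i < i')%N -> A i j != 0 -> A i' j' != 0 -> (j <= j')%N) ->
  totally_positive C A.
Proof.
move=> A_nneg A_stair r f g f_incr g_incr.
rewrite /determinant (bigD1 1%g) //= odd_perm1 expr0 mul1r.
rewrite [X in _ + X]big1 ?addr0 => [|s].
  by elim/big_ind: _ => // i _; rewrite mxE.
move=> s_neq1; have [/existsP[i /eqP Ai0]|] :=
    boolP [exists i, A (f i) (g (s i)) == 0].
  by rewrite (bigD1 i) //= mxE Ai0 mul0r mulr0.
rewrite negb_exists => /forallP A_neq0; case/eqP: s_neq1.
have s_incr (i j : 'I_r) : (i < j)%N -> (s i < s j)%N.
  move=> lt_ij; rewrite ltnNge leq_eqVlt; apply/negP => /predU1P[|lt_s].
    by move/val_inj/perm_inj => eq_ij; rewrite eq_ij ltnn in lt_ij.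
  have := A_stair _ _ _ _ (f_incr _ _ lt_ij) (A_neq0 i) (A_neq0 j).
  by rewrite leqNgt g_incr.
pose s' : {ffun 'I_r -> 'I_r} := [ffun i => s i].
pose id' : {ffun 'I_r -> 'I_r} := [ffun i => i].
(* Read s both as an increasing map after the identity and as the identity after s: its rank is 1 by
   the first reading and s by the second. *)
have s'_rank := @rank_perm _ _ s' 1%g; have id'_rank := @rank_perm _ _ id' s.
apply/permP => i; rewrite -s'_rank => [|k l].
  2: by rewrite !ffunE; apply: s_incr.
rewrite -id'_rank => [|k l]; last by rewrite !ffunE.
by congr (rank _ i); apply/ffunP => j; rewrite !ffunE perm1.
Qed.

(** A minor that uses the new row e_0 expands along it: only column 0 can contribute, and it can
    only be the first column chosen. The cofactor is a minor of [A]. *)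
Lemma tp_cons_row A : totally_positive C A -> totally_positive C (cons_row A).
Proof.
move=> A_tp [|r] f g f_incr g_incr; first by rewrite det_mx00.
case def_f0: (f ord0) => [|f0]; last first.
  have f_gt0 i : (0 < f i)%N.
    have [->|i_neq0] := eqVneq i ord0; first by rewrite def_f0.
    by apply: leq_ltn_trans (f_incr ord0 i _); rewrite ?lt0n.
  have -> : \matrix_(i < r.+1, j < r.+1) cons_row A (f i) (g j) =
      \matrix_(i, j) A (f i).-1 (g j).
    by apply/matrixP=> i j; rewrite !mxE; case: (f i) (f_gt0 i).
  by apply: A_tp => // i j /f_incr; case: (f i) (f_gt0 i) (f j) => // ? _ [].
have g_gt0 (j : 'I_r.+1) : j != ord0 -> (0 < g j)%N.
  by move=> j_neq0; apply: leq_ltn_trans (g_incr ord0 j _); rewrite ?lt0n.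
rewrite (expand_det_row _ ord0) (bigD1 ord0) //=.
rewrite big1 => [|j j_neq0]; last first.
  by rewrite mxE def_f0 /= -[_ == _]negbK -lt0n g_gt0 // mul0r.
rewrite addr0 mxE def_f0; apply: CM; first exact: cone_nat.
rewrite /cofactor addn0 expr0 mul1r.
have f_gt0 i : (0 < f (lift ord0 i))%N.
  by apply: leq_ltn_trans (f_incr ord0 _ _).
have -> : row' ord0 (col' ord0
      (\matrix_(i < r.+1, j < r.+1) cons_row A (f i) (g j))) =
    \matrix_(i < r, j < r) A (f (lift ord0 i)).-1 (g (lift ord0 j)).
  by apply/matrixP=> i j; rewrite !mxE; case: (f _) (f_gt0 i).
apply: A_tp => i j lt_ij; last by apply: g_incr.
have /f_incr : (lift ord0 i < lift ord0 j)%N by [].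
by case: (f (lift ord0 i)) (f_gt0 i) (f (lift ord0 j)) => // ? _ [].
Qed.

Lemma tp_output N P : totally_positive C P -> totally_positive C (output N P).
Proof.
move=> P_tp.
(* Zeroing the rows from b on makes an induction on b possible: the matrix for b + 1 is e_0 on top
   of the one for b times P. *)
pose O b i k := if (i < b)%N then output N P i k else 0.
suff O_tp b : totally_positive C (O b).
  by apply: tp_local => b; exists (O b) => // i j lt_i _; rewrite /O lt_i.
elim: b => [|b IHb].
  by apply: tp_staircase => // i i' j j'; rewrite /O eqxx.
apply: tp_local => b'; exists (cons_row (trunc_mul N (O b) P)).
  exact/tp_cons_row/tp_trunc_mul.
move=> [|i] j _ _ //; rewrite /O ltnS /= /trunc_mul; case: ifP => // _.
by rewrite big1 // => l _; rewrite mul0r.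
Qed.

(** The factors P move one at a time from the row vector to the column vector. The size [N.+1]
    guarantees that index 0 exists. *)
Lemma output_addn N P i j :
  output N.+1 P (i + j) 0 =
  \sum_(k < N.+1) output N.+1 P i k * output N.+1 (fun a b => P b a) j k.
Proof.
elim: j i => [|j IHj] i.
  rewrite addn0 (bigD1 ord0) //= mulr1 big1 ?addr0 // => k k_neq0.
  by rewrite (_ : (k == 0 :> nat) = false) ?mulr0 //; apply: negPf.
rewrite addnS -addSn IHj /=.
under eq_bigr => k _ do rewrite big_distrl /=.
rewrite exchange_big; apply: eq_bigr => l _ /=; rewrite big_distrr /=.
by apply: eq_bigr => k _; rewrite -mulrA [P _ _ * _]mulrC.
Qed.

Lemma tp_hankel_output N P :
  totally_positive C P ->
  hankel_totally_positive C (fun n => output N.+1 P n 0).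
Proof.
move=> P_tp; have PT_tp := tp_tr P_tp.
have Q_tp := tp_tr (tp_output N.+1 PT_tp).
apply: eq_tp (tp_trunc_mul N.+1 (tp_output N.+1 P_tp) Q_tp) => i j.
by rewrite output_addn.
Qed.

End TotalPositivity.

(** * The coefficientwise cones *)

Lemma semiring_cone_poly (R : comNzRingType) (C : R -> Prop) :
  semiring_cone C -> semiring_cone (fun p : {poly R} => forall i, C p`_i).
Proof.
case=> C0 C1 CD CM; split=> [i|i|p q Cp Cq i|p q Cp Cq i].
- by rewrite coef0.
- by rewrite coef1; case: (i == 0).
- by rewrite coefD; apply: CD.
by rewrite coefM; elim/big_ind: _ => // j _; apply: CM.
Qed.

Lemma semiring_cone_int : semiring_cone (fun a : int => 0 <= a).
Proof. by split=> // a b; [apply: addr_ge0 | apply: mulr_ge0]. Qed.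

Lemma coefwise_nneg_cone : semiring_cone coefwise_nneg.
Proof. exact: semiring_cone_poly semiring_cone_int. Qed.

Lemma coefwise_nneg2_cone : semiring_cone coefwise_nneg2.
Proof. exact: semiring_cone_poly coefwise_nneg_cone. Qed.

(** * The production matrix and its action on polynomials *)

Lemma sum_double (V : nmodType) N (F : nat -> V) :
  \sum_(l < N.*2) F l = \sum_(i < N) (F i.*2 + F i.*2.+1).
Proof.
by elim: N => [|N IHN]; rewrite ?big_ord0 // !big_ord_recr /= IHN addrA.
Qed.

Section ProductionMatrix.

Variables (R : comNzRingType) (lam x y : R).
Implicit Type p : {poly R}.

(** Row j lists the coefficients of [diff 'X^j]; likewise row j of [shift_mx] lists those of ('X +
    x) 'X^j. *)
Definition diff_mx (j k : nat) : R := (j == k)%:R + (j == k.+1)%:R * (y * j%:R).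

Definition shift_mx (j k : nat) : R := (j.+1 == k)%:R + (j == k)%:R * x.

(* left_mx and right_mx interleave the columns of I and diff_mx and the rows  *)
(* of (lam * y) I and shift_mx, so that their product is                      *)
(* (lam * y) I + diff_mx shift_mx.                                            *)
Definition left_mx (n l : nat) : R :=
  if odd l then diff_mx n l./2 else (n == l./2)%:R.

Definition right_mx (l k : nat) : R :=
  if odd l then shift_mx l./2 k else (l./2 == k)%:R * (lam * y).

Definition laguerre_prod N : nat -> nat -> R :=
  trunc_mul N diff_mx (trunc_mul N.*2 left_mx right_mx).

Definition diff p := p + y *: p^`().

Definition laguerre_step p :=
  (lam * y) *: diff p + ('X + x%:P) * diff (diff p).

Lemma sum_coef_delta N p k : (size p <= N)%N ->
  \sum_(j < N) p`_j * ((j : nat) == k)%:R = p`_k.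
Proof.
move=> le_pN; have [lt_kN|le_Nk] := ltnP k N.
  rewrite (bigD1 (Ordinal lt_kN)) //= eqxx mulr1 big1 ?addr0 // => j.
  by rewrite -val_eqE /= => /negPf->; rewrite mulr0.
rewrite nth_default ?(leq_trans le_pN) // big1 // => j _.
by rewrite ltn_eqF ?mulr0 // (leq_trans _ le_Nk).
Qed.

Lemma sum_coef_diff N p k :
  (size p <= N)%N -> \sum_(j < N) p`_j * diff_mx j k = (diff p)`_k.
Proof.
move=> le_pN; under eq_bigr => j _ do rewrite mulrDr.
rewrite big_split /= sum_coef_delta // coefD coefZ coef_deriv -mulr_natl.
congr (_ + _).
rewrite -(sum_coef_delta k.+1 le_pN) big_distrr big_distrr /=.
apply: eq_bigr => j _.
have [->|_] := eqVneq (j : nat) k.+1; first by rewrite mulr1 mul1r; ring.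
by rewrite !(mul0r, mulr0).
Qed.

Lemma sum_coef_shift N p k :
  (size p <= N)%N -> \sum_(j < N) p`_j * shift_mx j k = (('X + x%:P) * p)`_k.
Proof.
move=> le_pN; under eq_bigr => j _ do rewrite mulrDr mulrA.
rewrite big_split /= -big_distrl /= sum_coef_delta //.
rewrite mulrDl coefD coefCM coefXM [x * _]mulrC; congr (_ + _).
case: k => [|k] /=; first by rewrite big1 // => j _; rewrite mulr0.
by rewrite -(sum_coef_delta k le_pN); apply: eq_bigr => j _; rewrite eqSS.
Qed.

Lemma size_diff p : (size (diff p) <= size p)%N.
Proof.
rewrite (leq_trans (size_polyD _ _)) // geq_max leqnn.
rewrite (leq_trans (size_scale_leq _ _)) //.
have [->|p_neq0] := eqVneq p 0; first by rewrite deriv0.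
exact/ltnW/lt_size_deriv.
Qed.

Lemma sum_coef_laguerre_prod N p k : (size p <= N)%N ->
  \sum_(j < N) p`_j * laguerre_prod N j k = (laguerre_step p)`_k.
Proof.
move=> le_pN; pose q := diff p.
have le_qN : (size q <= N)%N by apply: leq_trans (size_diff p) le_pN.
have le_dqN : (size (diff q) <= N)%N by apply: leq_trans (size_diff q) le_qN.
transitivity (\sum_(i < N) q`_i * trunc_mul N.*2 left_mx right_mx i k).
  under eq_bigr => j _ do rewrite big_distrr /=.
  rewrite exchange_big; apply: eq_bigr => i _ /=.
  rewrite -(sum_coef_diff i le_pN) big_distrl.
  by apply: eq_bigr => j _; rewrite mulrA.
under eq_bigr => j _ do rewrite big_distrr /=.
rewrite exchange_big /=.
pose F l := (\sum_(i < N) q`_i * left_mx i l) * right_mx l k.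
transitivity (\sum_(l < N.*2) F l).
  apply: eq_bigr => l _; rewrite /F big_distrl.
  by apply: eq_bigr => j _; rewrite mulrA.
rewrite sum_double coefD coefZ -(sum_coef_shift k le_dqN).
rewrite -(sum_coef_delta k le_qN) big_distrr -big_split /=.
apply: eq_bigr => m _; rewrite /F /left_mx /right_mx /=.
rewrite odd_double /= uphalf_double doubleK.
rewrite sum_coef_diff // sum_coef_delta //; congr (_ + _).
by rewrite [LHS]mulrA [RHS]mulrC.
Qed.

Lemma size_laguerre_step p : (size (laguerre_step p) <= (size p).+1)%N.
Proof.
have le_dp := size_diff p; have le_ddp := leq_trans (size_diff _) le_dp.
rewrite (leq_trans (size_polyD _ _)) // geq_max.
rewrite (leq_trans (size_scale_leq _ _)) ?(leq_trans le_dp) //=.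
rewrite (leq_trans (size_polyMleq _ _)) // size_XaddC /=; exact: le_ddp.
Qed.

Lemma output_laguerre_prod N n : (n <= N)%N ->
  forall k, output N (laguerre_prod N) n k = (iter n laguerre_step 1)`_k.
Proof.
elim: n => [|n IHn] lt_nN k; first by rewrite coef1.
rewrite /= -(@sum_coef_laguerre_prod N).
  by apply: eq_bigr => j _; rewrite IHn // ltnW.
apply: leq_trans lt_nN; elim: n {IHn} => [|n IHn] /=.
  by rewrite size_poly1.
exact: leq_trans (size_laguerre_step _) _.
Qed.

Variable C : R -> Prop.
Hypotheses (C_cone : semiring_cone C) (C_lam : C lam) (C_x : C x) (C_y : C y).

Lemma diff_mx_nneg j k : C (diff_mx j k).
Proof.
case: (C_cone) => _ _ CD CM.
by apply/CD/CM/CM => //; apply: cone_nat.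
Qed.

Lemma shift_mx_nneg j k : C (shift_mx j k).
Proof.
case: (C_cone) => _ _ CD CM.
by apply/CD/CM => //; apply: cone_nat.
Qed.

Lemma diff_mx_support j k : diff_mx j k != 0 -> (k <= j <= k.+1)%N.
Proof.
rewrite /diff_mx; have [->|_] := eqVneq j k; first by rewrite leqnn leqnSn.
by have [->|_] := eqVneq j k.+1; rewrite ?leqnn ?leqnSn // mul0r addr0 eqxx.
Qed.

Lemma shift_mx_support j k : shift_mx j k != 0 -> (j <= k <= j.+1)%N.
Proof.
rewrite /shift_mx; have [->|_] := eqVneq j k; first by rewrite leqnn leqnSn.
by have [<-|_] := eqVneq j.+1 k; rewrite ?leqnn ?leqnSn // mul0r addr0 eqxx.
Qed.

Lemma delta_support (j k : nat) : (j == k)%:R != 0 :> R -> j = k.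
Proof. by have [//|_] := eqVneq j k; rewrite eqxx. Qed.

Lemma tp_diff_mx : totally_positive C diff_mx.
Proof.
apply: tp_staircase => // [|i i' j j' lt_i /diff_mx_support + /diff_mx_support].
  exact: diff_mx_nneg.
lia.
Qed.

(** Row n lives on columns 2n - 1, 2n, 2n + 1, so successive rows overlap in one column only. This
    depends on putting each column of I before the matching column of [diff_mx]. *)
Lemma tp_left_mx : totally_positive C left_mx.
Proof.
apply: tp_staircase => // [n l|i i' j j' lt_i].
  by rewrite /left_mx; case: ifP => _; [apply: diff_mx_nneg | apply: cone_nat].
rewrite /left_mx; have := odd_double_half j; have := odd_double_half j'.
case: (odd j); case: (odd j') => /= def_j' def_j.
- by move=> /diff_mx_support + /diff_mx_support; lia.
- by move=> /diff_mx_support + /delta_support; lia.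
- by move=> /delta_support + /diff_mx_support; lia.
by move=> /delta_support + /delta_support; lia.
Qed.

Lemma tp_right_mx : totally_positive C right_mx.
Proof.
case: (C_cone) => _ _ _ CM.
have supp l k : right_mx l k != 0 -> (l./2 <= k <= l./2 + odd l)%N.
  rewrite /right_mx; case: (odd l).
    by rewrite addn1; apply: shift_mx_support.
  rewrite addn0; have [->|_] := eqVneq l./2 k; first by rewrite leqnn.
  by rewrite mul0r eqxx.
apply: tp_staircase => // [l k|i i' j j' lt_i /supp + /supp].
  rewrite /right_mx; case: ifP => _; first exact: shift_mx_nneg.
  by apply/CM/CM => //; apply: cone_nat.
have := odd_double_half i; have := odd_double_half i'; lia.
Qed.

Lemma tp_laguerre_prod N : totally_positive C (laguerre_prod N).
Proof.
apply: tp_trunc_mul => //; first exact: tp_diff_mx.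
by apply: tp_trunc_mul => //; [apply: tp_left_mx | apply: tp_right_mx].
Qed.

Lemma tp_iter_laguerre_step :
  totally_positive C (fun n k => (iter n laguerre_step 1)`_k).
Proof.
apply: tp_local => b; exists (output b (laguerre_prod b)).
  by apply: tp_output => //; apply: tp_laguerre_prod.
by move=> i j lt_ib _; rewrite output_laguerre_prod // ltnW.
Qed.

Lemma hankel_tp_iter_laguerre_step :
  hankel_totally_positive C (fun n => (iter n laguerre_step 1)`_0).
Proof.
apply: tp_local => b; pose N := (b + b)%N.
exists (fun i j => output N.+1 (laguerre_prod N.+1) (i + j) 0).
  by apply: tp_hankel_output => //; apply: tp_laguerre_prod.
move=> i j lt_ib lt_jb; rewrite output_laguerre_prod //.
by rewrite ltnW // ltnS leq_add // ltnW.
Qed.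

End ProductionMatrix.

(** * Identities for the homogenized Laguerre polynomials *)

Section LaguerrePolynomials.

Variable R : comNzRingType.
Implicit Types lam x y : R.

Definition hlaguerre lam y n : {poly R} :=
  \poly_(k < n.+1) ('C(n, k)%:R * rising (lam + k%:R) (n - k) * y ^+ (n - k)).

Lemma coef_hlaguerre lam y n k :
  (hlaguerre lam y n)`_k =
  'C(n, k)%:R * rising (lam + k%:R) (n - k) * y ^+ (n - k).
Proof.
by rewrite coef_poly ltnS; case: leqP => // /bin_small->; rewrite !mul0r.
Qed.

Lemma risingS lam m : rising lam m.+1 = lam * rising (lam + 1) m.
Proof.
rewrite /rising big_ord_recl addr0; congr (_ * _); apply: eq_bigr => i _.
by rewrite -addrA nat1r.
Qed.

Lemma risingSr lam m : rising lam m.+1 = rising lam m * (lam + m%:R).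
Proof. by rewrite /rising big_ord_recr. Qed.

(** With m + 1 = n - k and Q = (lambda + k + 1)^[m], use (k + 1) 'C(n, k + 1) = (m + 1) 'C(n, k);
    the claim becomes (lambda + k) Q + (m + 1) Q = (lambda + k + 1)^[m + 1]. *)
Lemma diff_hlaguerre lam y n :
  diff y (hlaguerre lam y n) = hlaguerre (lam + 1) y n.
Proof.
apply/polyP => k; rewrite coefD coefZ coef_deriv !coef_hlaguerre.
rewrite -[_ *+ k.+1]mulr_natl.
have [lt_nk|lt_kn|->] := ltngtP n k.
- by rewrite (bin_small lt_nk) (bin_small (leqW lt_nk)) !(mul0r, mulr0) addr0.
- have [m def_m] : exists m, n = (k + m.+1)%N.
    by exists (n - k.+1)%N; rewrite -addSnnS subnKC.
  have def_nk : (n - k = m.+1)%N by rewrite def_m addKn.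
  have -> : (n - k.+1 = m)%N by rewrite def_m -addSnnS addKn.
  rewrite def_nk.
  rewrite risingS risingSr.
  have := mul_bin_left n k; rewrite def_nk => /(congr1 (fun i => i%:R : R)).
  rewrite !natrM => bin_eq.
  have -> : lam + k.+1%:R = lam + k%:R + 1 by rewrite -addrA natr1.
  have -> : lam + 1 + k%:R = lam + k%:R + 1 by ring.
  rewrite mulrA [_%:R * (_%:R * _ * _)]mulrA [k.+1%:R * (_ * _)]mulrA bin_eq.
  rewrite -[m.+1%:R]natr1 exprS; ring.
by rewrite (bin_small (ltnSn k)) subnn !(mul0r, mulr0) addr0 /rising !big_ord0.
Qed.

Lemma hlaguerreS lam y n : hlaguerre lam y n.+1 =
  (lam * y) *: hlaguerre (lam + 1) y n + 'X * hlaguerre (lam + 1 + 1) y n.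
Proof.
apply/polyP => -[|k]; rewrite coefD coefZ coefXM !coef_hlaguerre /=.
  by rewrite !bin0 !subn0 !addr0 risingS exprS; ring.
rewrite subSS.
have [lt_nk|lt_kn|->] := ltngtP n k.
- rewrite binS (bin_small lt_nk) (bin_small (leqW lt_nk)).
  by rewrite !(mul0r, mulr0) addr0.
- have [m def_m] : exists m, n = (k + m.+1)%N.
    by exists (n - k.+1)%N; rewrite -addSnnS subnKC.
  have def_nk : (n - k = m.+1)%N by rewrite def_m addKn.
  have -> : (n - k.+1 = m)%N by rewrite def_m -addSnnS addKn.
  rewrite def_nk.
  have := mul_bin_left n k; rewrite def_nk => /(congr1 (fun i => i%:R : R)).
  rewrite !natrM -[k.+1%:R]natr1 -[m.+1%:R]natr1 => bin_eq.
  rewrite binS natrD risingS risingSr.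
  have -> : lam + (k%:R + 1) + 1 = lam + 1 + 1 + k%:R by ring.
  have -> : lam + 1 + (k%:R + 1) = lam + 1 + 1 + k%:R by ring.
  set q := rising _ _; rewrite exprS.
  apply/eqP; rewrite -subr_eq0; apply/eqP.
  (* After factoring out q = (lambda + k + 2)^[m], the two sides differ by a multiple of the
     identity [bin_eq]. *)
  transitivity (((k%:R + 1) * 'C(n, k.+1)%:R - (m%:R + 1) * 'C(n, k)%:R) *
    q * y * y ^+ m); first ring.
  by rewrite bin_eq subrr !mul0r.
rewrite !binn (bin_small (ltnSn k)) subnn !(mul0r, mulr0) add0r.
by rewrite /rising !big_ord0.
Qed.

Lemma iter_laguerre_step lam x y n :
  iter n (laguerre_step lam x y) 1 = hlaguerre lam y n \Po ('X + x%:P).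
Proof.
have diff_comp p : diff y (p \Po ('X + x%:P)) = diff y p \Po ('X + x%:P).
  rewrite /diff deriv_comp derivD derivX derivC addr0 mulr1.
  by rewrite comp_polyD comp_polyZ.
elim: n => [|n /= ->].
  rewrite -[1](comp_polyC _ ('X + x%:P)); congr (_ \Po _); apply/polyP => k.
  rewrite coef_hlaguerre coefC; case: k => [|k].
    2: by rewrite bin_small ?mul0r.
  by rewrite bin0 subn0 /rising big_ord0 !mulr1.
rewrite /laguerre_step !diff_comp !diff_hlaguerre hlaguerreS.
by rewrite comp_polyD comp_polyZ comp_polyM comp_polyX.
Qed.

Lemma coef_XaddC_exp x n k : (('X + x%:P) ^+ n)`_k = 'C(n, k)%:R * x ^+ (n - k).
Proof.
elim: n k => [|n IHn] k; first by case: k => [|k]; rewrite coef1 ?mulr1 ?mul0r.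
rewrite exprS mulrDl coefD coefXM coefCM; case: k => [|k] /=.
  by rewrite IHn !bin0 !subn0 add0r !mul1r exprS.
rewrite !IHn binS natrD subSS addrC mulrDl.
congr (_ + _); have [lt_kn|le_nk] := ltnP k n.
  2: by rewrite bin_small ?mul0r ?mulr0.
by rewrite mulrCA -exprS -subSn.
Qed.

(** Row i of [binomial_mx x] lists the coefficients of ('X + x)^i, so right multiplication by it is
    the substitution of 'X + x. *)
Lemma iter_laguerre_step_mx lam x n k :
  (iter n (laguerre_step lam x 1) 1)`_k =
  lower_mul (laguerre_mx lam) (binomial_mx x) n k.
Proof.
rewrite iter_laguerre_step /hlaguerre poly_def raddf_sum coef_sum.
apply: eq_bigr => i _; have le_in : (i <= n)%N by rewrite -ltnS.
rewrite /= comp_polyZ comp_Xn_poly coefZ coef_XaddC_exp.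
by rewrite /laguerre_mx le_in expr1n mulr1.
Qed.

Lemma iter_laguerre_step_mx0 lam n k :
  (iter n (laguerre_step lam 0 1) 1)`_k = laguerre_mx lam n k.
Proof.
rewrite iter_laguerre_step addr0 comp_polyXr coef_hlaguerre expr1n mulr1.
rewrite /laguerre_mx.
by case: leqP => // /bin_small->; rewrite mul0r.
Qed.

Lemma iter_laguerre_step0 lam x y n :
  (iter n (laguerre_step lam x y) 1)`_0 = (hlaguerre lam y n).[x].
Proof.
by rewrite iter_laguerre_step -horner_coef0 horner_comp !hornerE.
Qed.

Lemma horner_hlaguerre lam x n : (hlaguerre lam 1 n).[x] = laguerre lam x n.
Proof.
by rewrite horner_poly; apply: eq_bigr => k _; rewrite expr1n mulr1.
Qed.

Lemma horner_hlaguerre_rev lam x n :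
  (hlaguerre lam x n).[1] = rev_laguerre lam x n.
Proof.
rewrite horner_poly [LHS](reindex_inj rev_ord_inj) /=; apply: eq_bigr => k _.
have le_kn : (k <= n)%N by rewrite -ltnS.
by rewrite subSS bin_sub // subKn // expr1n mulr1.
Qed.

End LaguerrePolynomials.

Theorem theorem1p1 :
  [/\ totally_positive coefwise_nneg (laguerre_mx ('X : {poly int})),
      totally_positive coefwise_nneg2
        (lower_mul (laguerre_mx (('X : {poly int})%:P))
                   (binomial_mx ('X : {poly {poly int}}))),
      hankel_totally_positive coefwise_nneg2
        (laguerre (('X : {poly int})%:P) ('X : {poly {poly int}}))
    & hankel_totally_positive coefwise_nneg2
        (rev_laguerre (('X : {poly int})%:P) ('X : {poly {poly int}}))].
Proof.
have cone := coefwise_nneg_cone; have cone2 := coefwise_nneg2_cone.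
have [C0 C1 _ _] := cone; have [C0' C1' _ _] := cone2.
have C_X : coefwise_nneg 'X by move=> i; rewrite coefX; case: eqP.
have C_x : coefwise_nneg2 'X.
  by move=> i; rewrite coefX; case: eqP => _; [apply: C1 | apply: C0].
have C_lam : coefwise_nneg2 'X%:P.
  by move=> i; rewrite coefC; case: eqP => // _; apply: C0.
split.
- apply: eq_tp (tp_iter_laguerre_step cone C_X C0 C1) => n k.
  exact: iter_laguerre_step_mx0.
- apply: eq_tp (tp_iter_laguerre_step cone2 C_lam C_x C1') => n k.
  exact: iter_laguerre_step_mx.
- apply: eq_tp (hankel_tp_iter_laguerre_step cone2 C_lam C_x C1') => i j.
  by rewrite iter_laguerre_step0 horner_hlaguerre.
apply: eq_tp (hankel_tp_iter_laguerre_step cone2 C_lam C1' C_x) => i j.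
by rewrite iter_laguerre_step0 horner_hlaguerre_rev.
Qed.
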